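(* Let $\mathbb{M}=(M;d)$ be a countable homogeneous indivisible metric space. Then $\mathbb{M}^\ast=(M;d^\ast)$ is a homogeneous indivisible ultrametric space.
   Context: A metric space is homogeneous if every isometry between two of its finite subspaces extends to an isometry of the space onto itself. A metric space is indivisible if for every partition of its underlying set into two parts, at least one of the parts contains an isometric copy of the space. A metric space is ultrametric if $d(x,z)\leq\max\{d(x,y),d(y,z)\}$ for all $x,y,z$. For $\epsilon>0$, an $\epsilon$-chain (or $\epsilon$-sequence) is a finite sequence $a_0,\dots,a_n$ of elements of $M$ with $d(a_i,a_{i+1})\leq\epsilon$ for all $i<n$. Define $$d^\ast(x,y):=\inf\{\epsilon>0 : \text{there exists an } \epsilon\text{-sequence containing } x \text{ and } y\}.$$ (A countable indivisible metric space is totally Cantor disconnected, i.e. it has no subset with more than one point in which any two points can be joined, within the subset, by an $\epsilon$-chain for every $\epsilon>0$; the paper introduces $d^\ast$ for totally Cantor disconnected spaces.) *)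

(* Defs.v *)
From mathcomp Require Import all_boot all_order all_algebra.
From mathcomp Require Import all_classical all_reals all_analysis.

Set Implicit Arguments.
Unset Strict Implicit.
Unset Printing Implicit Defensive.

Import Order.TTheory GRing.Theory Num.Theory.

Local Open Scope classical_set_scope.
Local Open Scope ring_scope.

(* [f] restricts to an isometry of the subspace [A] onto the subspace [B];
   its values outside [A] are irrelevant. *)
Definition isometry (R : realType) (M : metricType R) (A B : set M)
    (f : M -> M) : Prop :=
  set_bij A B f /\ (forall x y, A x -> A y -> mdist (f x) (f y) = mdist x y).

Definition homogeneous (R : realType) (M : metricType R) : Prop :=
  forall (A B : set M) (f : M -> M),
    finite_set A -> finite_set B -> isometry A B f ->
    exists g : M -> M, isometry setT setT g /\ (forall x, A x -> g x = f x).

Definition contains_copy (R : realType) (M : metricType R) (A : set M) : Prop :=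
  exists (B : set M) (f : M -> M), B `<=` A /\ isometry setT B f.

(* Allowing an empty part is harmless: the other part is then the whole
   space. *)
Definition indivisible (R : realType) (M : metricType R) : Prop :=
  forall A B : set M, A `|` B = setT -> A `&` B = set0 ->
    contains_copy A \/ contains_copy B.

Definition ultrametric (R : realType) (M : metricType R) : Prop :=
  forall x y z : M, mdist x z <= Num.max (mdist x y) (mdist y z).

Definition eps_chain (R : realType) (M : metricType R) (e : R) (s : seq M)
    : bool :=
  sorted (fun a b => mdist a b <= e) s.

(* The set is bounded below by 0, and nonempty because [:: x; y] is an
   e-chain for every e >= mdist x y; so [inf] is a genuine infimum. *)
Definition dstar (R : realType) (M : metricType R) (x y : M) : R :=
  inf [set e : R | 0 < e /\
    exists s : seq M, [/\ eps_chain e s, x \in s & y \in s]].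

(* Main.v *)
Require Import Defs.
From HB Require Import structures.
From mathcomp Require Import all_boot all_order all_algebra.
From mathcomp Require Import all_classical all_reals all_analysis.
From mathcomp Require Import lra.

(** Two observations reduce the theorem to one colouring argument.

    First, every distance-preserving self-map f of a homogeneous M preserves
    dstar.  The map is typically not onto, so chains in M joining f x to f y
    need not lie in its image; but homogeneity extends the partial isometry
    sending x, y to f x, f y to an isometry g of M onto itself, and a
    bijective isometry preserves dstar because it transports chains in both
    directions ([homogeneous_dstar_map]).  So a copy of (M, d) inside a part of
    a partition is already a copy of (M, dstar), and indivisibility carries
    over unchanged.

    Second, an ultrametric space whose isometry group acts transitively on
    points is homogeneous ([ultrametric_transitive_homogeneous]): a finite
    partial isometry is extended one point at a time, each time correcting the
    image of the new point by exchanging two disjoint open balls.  For dstar,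
    transitivity is inherited from M, and the ultrametric inequality is
    concatenation of chains.

    What remains is that dstar separates points.  If x <> y had dstar x y = 0,
    then by homogeneity every point p would have a partner at distance
    r = d x y joined to p by e-chains for all e > 0.  A colouring of M in
    concentric shells around the points of an enumeration of M
    ([countable_indivisible_linked_near]) confines, in every monochromatic copy
    of M, the fine chains starting from some point to within distance < r, a
    contradiction. *)

Set Implicit Arguments.
Unset Strict Implicit.
Unset Printing Implicit Defensive.

Import Order.TTheory GRing.Theory Num.Theory.

Local Open Scope classical_set_scope.
Local Open Scope ring_scope.

Local Notation isometry := Defs.isometry.

(** * Isometries and homogeneity *)

Section Isometries.
Context {R : realType} {M : metricType R}.
Implicit Types (f g : M -> M).

Definition preserves_mdist f := forall x y, mdist (f x) (f y) = mdist x y.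

Lemma preserves_mdist_inj f : preserves_mdist f -> injective f.
Proof.
by move=> fd x y fxy; apply: mdist_positivity; rewrite -fd fxy mdistxx.
Qed.

Lemma preserves_mdist_isometry f :
  preserves_mdist f -> (forall y, exists x, f x = y) -> isometry setT setT f.
Proof.
move=> fd fsurj; split; last by move=> x y _ _.
split=> [//|x y _ _|y _ /=]; first exact: preserves_mdist_inj.
by have [x <-] := fsurj y; exists x.
Qed.

Lemma isometry_preserves_mdist A f : isometry setT A f -> preserves_mdist f.
Proof. by move=> [_ fd] x y; exact: fd. Qed.

Lemma isometry_inverse f : isometry setT setT f ->
  exists g, [/\ preserves_mdist g, cancel f g & cancel g f].
Proof.
move=> fiso; have fd := isometry_preserves_mdist fiso.
have [[_ _ fsurj] _] := fiso.
have /choice[g gK] : forall y, exists x, f x = y.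
  by move=> y; have [x _ <-] := fsurj y I; exists x.
exists g; split=> // [x y|x]; first by rewrite -fd !gK.
by apply: (preserves_mdist_inj fd); rewrite gK.
Qed.

End Isometries.

Lemma homogeneous_pair (R : realType) (M : metricType R) (x y x' y' : M) :
  homogeneous M -> mdist x' y' = mdist x y ->
  exists g : M -> M, [/\ isometry setT setT g, g x = x' & g y = y'].
Proof.
move=> hom dxy.
(* If x = y, then also x' = y', so f takes the right value at y in all cases. *)
pose f z := if z == x then x' else y'.
have fx : f x = x' by rewrite /f eqxx.
have fy : f y = y'.
  rewrite /f; case: eqP => // yx; apply: mdist_positivity.
  by rewrite dxy yx mdistxx.
have fd u v : [set x; y] u -> [set x; y] v -> mdist (f u) (f v) = mdist u v.
  by move=> [|] -> [|] ->; rewrite ?fx ?fy ?mdistxx//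
    metric_sym dxy metric_sym.
have [|||g [giso gf]] := hom [set x; y] [set x'; y'] f.
- exact: finite_set2.
- exact: finite_set2.
- split=> //; split.
  + by move=> u [|] ->; rewrite ?fx ?fy; [left|right].
  + move=> u v /set_mem uA /set_mem vA fuv.
    by apply: mdist_positivity; rewrite -fd// fuv mdistxx.
  + by move=> u [|] -> /=; [exists x => //; left|exists y => //; right].
- exists g; split=> //.
  + by rewrite gf//; left.
  + by rewrite gf//; right.
Qed.

Lemma homogeneous_transitive (R : realType) (M : metricType R) :
  homogeneous M ->
  forall x y : M, exists g : M -> M, isometry setT setT g /\ g x = y.
Proof.
move=> hom x y; have [|g [giso gx _]] := @homogeneous_pair R M x x y y hom.
  by rewrite !mdistxx.
by exists g.
Qed.

(** * Points joined by chains *)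

Section Linked.
Context {R : realType} {M : metricType R}.
Implicit Types (x y z : M) (e : R) (f : M -> M).

(** A chain that starts at x and ends at y; unlike mere occurrence of x and y
    in a common chain, this form composes and supports induction along the
    chain. *)
Definition linked e x y :=
  exists2 p : seq M, path (fun a b => mdist a b <= e) x p & last x p = y.

Lemma linkedxx e x : linked e x x.
Proof. by exists [::]. Qed.

Lemma linked1 e x y : mdist x y <= e -> linked e x y.
Proof. by move=> xy; exists [:: y]; rewrite //= xy. Qed.

Lemma linked_trans e y x z : linked e x y -> linked e y z -> linked e x z.
Proof.
move=> [p xp <-] [q yq <-]; exists (p ++ q); first by rewrite cat_path xp.
by rewrite last_cat.
Qed.

Lemma linked_ind e (P : M -> Prop) :
  (forall a b, mdist a b <= e -> P a -> P b) ->
  forall x y, linked e x y -> P x -> P y.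
Proof.
move=> Pstep x y [p + <-]; elim: p x => //= a p IH x /andP[xa ap] Px.
by apply: IH => //; exact: Pstep Px.
Qed.

Lemma linked_sym e x y : linked e x y -> linked e y x.
Proof.
move=> xy; apply: (linked_ind (P := linked e ^~ x) _ xy (linkedxx e x)) => a b ab ax.
by apply: linked_trans ax; apply: linked1; rewrite metric_sym.
Qed.

Lemma linked_le e e' x y : e <= e' -> linked e x y -> linked e' x y.
Proof.
move=> ee' xy; apply: (linked_ind (P := linked e' x) _ xy (linkedxx e' x)) => a b ab xa.
by apply: linked_trans xa _; apply: linked1; exact: le_trans ee'.
Qed.

Lemma linked_map e f x y :
  preserves_mdist f -> linked e x y -> linked e (f x) (f y).
Proof.
move=> fd xy.
apply: (linked_ind (P := fun z => linked e (f x) (f z)) _ xy (linkedxx e _)).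
by move=> a b ab xa; apply: linked_trans xa _; apply: linked1; rewrite fd.
Qed.

Lemma eps_chain_linked e x y :
  (exists s : seq M, [/\ eps_chain e s, x \in s & y \in s]) <-> linked e x y.
Proof.
split=> [[s []]|[p xp <-]]; last first.
  by exists (x :: p); rewrite mem_head mem_last.
case: s => [//|a s] + xs ys.
rewrite /eps_chain /= => es.
suff from_head b : b \in a :: s -> linked e a b.
  by apply: (linked_trans (linked_sym (from_head x xs))); exact: from_head.
elim: s {xs ys} a es => [|c s IH] a /=.
  by rewrite inE => _ /eqP ->; exact: linkedxx.
move=> /andP[ac cs]; rewrite inE => /predU1P[->|]; first exact: linkedxx.
by move=> bs; apply: linked_trans (linked1 ac) _; exact: IH.
Qed.

End Linked.

(** * The distance dstar *)

Section Dstar.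
Context {R : realType} {M : metricType R}.
Implicit Types (x y z : M) (e : R) (f : M -> M).

Let E x y := [set e : R | 0 < e /\
  exists s : seq M, [/\ eps_chain e s, x \in s & y \in s]].

Let E_lbound x y : lbound (E x y) 0.
Proof. by move=> e [/ltW]. Qed.

Let E_neq0 x y : E x y !=set0.
Proof.
exists (mdist x y + 1); split; first by rewrite ltr_wpDl// mdist_ge0.
by apply/eps_chain_linked/linked1; rewrite lerDl.
Qed.

Lemma dstar_ge0 x y : 0 <= dstar x y.
Proof. by apply: lb_le_inf; [exact: E_neq0|exact: E_lbound]. Qed.

Lemma dstar_lt_linked e x y : dstar x y < e -> linked e x y.
Proof.
move=> xye; have [|e' [_ /eps_chain_linked xy] /ltW e'e] := inf_lt _ xye.
  exact: E_neq0.
exact: linked_le xy.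
Qed.

Lemma dstar_le e x y :
  0 <= e -> (forall e', e < e' -> linked e' x y) -> dstar x y <= e.
Proof.
move=> e0 xye; apply/ler_addgt0Pr => d d0.
apply: ge_inf; first by exists 0; exact: E_lbound.
split; first by rewrite ltr_wpDl.
by apply/eps_chain_linked/xye; rewrite ltrDl.
Qed.

Lemma dstarxx x : dstar x x = 0.
Proof.
apply/eqP; rewrite eq_le dstar_ge0 andbT.
by apply: dstar_le => // e _; exact: linkedxx.
Qed.

Lemma dstar_sym x y : dstar x y = dstar y x.
Proof.
suff le_dstar (a b : M) : dstar a b <= dstar b a.
  by apply/eqP; rewrite eq_le !le_dstar.
apply: dstar_le => [|e bae]; first exact: dstar_ge0.
by apply: linked_sym; exact: dstar_lt_linked.
Qed.

Lemma dstar_ultra x y z : dstar x z <= Num.max (dstar x y) (dstar y z).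
Proof.
apply: dstar_le => [|e]; first by rewrite le_max dstar_ge0.
rewrite gt_max => /andP[xye yze].
by apply: (@linked_trans _ _ _ y); exact: dstar_lt_linked.
Qed.

Lemma dstar_triangle y x z : dstar x z <= dstar x y + dstar y z.
Proof.
apply: le_trans (dstar_ultra x y z) _.
by rewrite ge_max lerDl lerDr !dstar_ge0.
Qed.

(** Only one inequality holds for a general distance-preserving map: f y may be
    reachable from f x by finer chains that leave the image of f. *)
Lemma dstar_map_le f x y : preserves_mdist f -> dstar (f x) (f y) <= dstar x y.
Proof.
move=> fd; apply: dstar_le => [|e xye]; first exact: dstar_ge0.
by apply: linked_map => //; exact: dstar_lt_linked.
Qed.

Lemma dstar_isometry f x y :
  isometry setT setT f -> dstar (f x) (f y) = dstar x y.
Proof.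
move=> fiso; have [g [gd fK _]] := isometry_inverse fiso.
have fd := isometry_preserves_mdist fiso.
apply/eqP; rewrite eq_le dstar_map_le//=.
by rewrite -{1}[x]fK -{1}[y]fK dstar_map_le.
Qed.

(** On the two points x and y, f agrees with an isometry of M onto itself, which
    supplies the inequality missing in [dstar_map_le]. *)
Lemma homogeneous_dstar_map f x y : homogeneous M ->
  preserves_mdist f -> dstar (f x) (f y) = dstar x y.
Proof.
move=> hom fd; have [g [giso <- <-]] := homogeneous_pair hom (fd x y).
exact: dstar_isometry.
Qed.

End Dstar.

(** * Concentric shells and separation of points *)

Section Shells.
Context {R : realType}.
Implicit Types (r t : R) (n : nat).

(** The open ball of radius r is cut into infinitely many spherical shells, the
    n-th one being where 1 / (r - t) lies in [n, n + 1), t the distance to the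
    centre; they get thinner and accumulate at the boundary of the ball. *)
Definition shell r t : nat := Num.truncn (r - t)^-1.

(** The thickness of shell n.+1. *)
Definition shell_width n : R := n.+1%:R^-1 - n.+2%:R^-1.

Lemma shell_width_gt0 n : 0 < shell_width n.
Proof. by rewrite subr_gt0 ltf_pV2 ?posrE ?ltr0n// ltr_nat. Qed.

Lemma shell_leq r t n : t < r -> (shell r t <= n)%N = (n.+1%:R^-1 < r - t).
Proof.
move=> tr; rewrite truncn_le_nat -[RHS]ltf_pV2 ?invrK// posrE.
  by rewrite subr_gt0.
by rewrite invr_gt0 ltr0n.
Qed.

(** A step shorter than the thickness of shell n.+1 cannot jump over that shell,
    so from the shells up to n it can at most land in it, and parity tells shell
    n.+1 from shell n. *)
Lemma shell_trap r t t' n : t < r -> (shell r t <= n)%N ->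
  t' <= t + shell_width n ->
  t' < r /\ (odd (shell r t') = odd n -> (shell r t' <= n)%N).
Proof.
move=> tr; rewrite shell_leq // /shell_width => tn tt'.
have n2 : 0 < (n.+2%:R : R)^-1 by rewrite invr_gt0 ltr0n.
move: tn tt' n2 (@shell_leq r t' n.+1).
move: (n.+1%:R^-1) (n.+2%:R^-1) => p q tn tt' q0 shellE.
have t'r : t' < r by lra.
split=> //.
have : (shell r t' <= n.+1)%N by rewrite shellE//; lra.
by rewrite leq_eqVlt => /predU1P[-> /=|//]; case: odd.
Qed.

End Shells.

Lemma exists_min_index (T : Type) (idx : T -> nat) (P : T -> Prop) :
  (exists x, P x) -> exists2 x, P x & forall y, P y -> (idx x <= idx y)%N.
Proof.
move=> exP.
have exn : exists n, `[< exists2 x, P x & idx x = n >].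
  by have [x Px] := exP; exists (idx x); apply/asboolP; exists x.
case: (ex_minnP exn) => n /asboolP[x Px <-] min; exists x => // y Py.
by apply: min; apply/asboolP; exists y.
Qed.

(** Colour z by the parity of its shell in the ball of radius r / 2 around c z,
    the point of least index within r / 2 of z.  Given a monochromatic copy
    f(M), choose x such that the index of a = c (f x) is least.  Minimality
    makes a the centre used by every point of f(M) in the ball around a, so
    within that ball the colour of the copy is exactly the parity of the shell
    around a.  A fine enough chain in f(M) starting at f x would have to enter
    the next shell, of the other colour, before leaving the ball; hence it stays
    within r / 2 of a, and its end is within r of f x. *)
Lemma countable_indivisible_linked_near (R : realType) (M : metricType R)
    (x0 : M) (r : R) :
  countable [set: M] -> indivisible M -> 0 < r ->
  exists x : M, forall y : M, (forall e, 0 < e -> linked e x y) -> mdist x y < r.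
Proof.
move=> /countable_injP[idx idx_inj] indiv r0.
pose rho := r / 2.
have rho0 : 0 < rho by rewrite divr_gt0.
have /choice[c cP] : forall x : M, exists a : M, mdist a x < rho /\
    forall b : M, mdist b x < rho -> (idx a <= idx b)%N.
  move=> x; have [|a ax amin] := @exists_min_index M idx (fun a : M => mdist a x < rho).
    by exists x; rewrite mdistxx.
  by exists a.
pose color (x : M) := odd (shell rho (mdist (c x) x)).
have [f [fd [b fb]]] : exists f : M -> M, preserves_mdist f /\
    exists b, forall x, color (f x) = b.
  have [| |[B [f [BA fiso]]]|[B [f [BA fiso]]]] :=
    indiv [set x | color x] [set x | ~~ color x].
  - by apply/seteqP; split=> // x _; case: (boolP (color x)); [left|right].
  - by apply/seteqP; split=> // x [/= ->].
  - exists f; split; first exact: isometry_preserves_mdist fiso.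
    by exists true => x; apply: BA; have [[fB _ _] _] := fiso; exact: fB.
  - exists f; split; first exact: isometry_preserves_mdist fiso.
    exists false => x; apply/negbTE/BA.
    by have [[fB _ _] _] := fiso; exact: fB.
have [x _ xmin] : exists2 x, True & forall y, True -> (idx (c (f x)) <= idx (c (f y)))%N.
  apply: (@exists_min_index M (fun x => idx (c (f x)))).
  by exists x0.
pose a := c (f x).
have ca y : mdist a (f y) < rho -> c (f y) = a.
  move=> ay; apply: idx_inj; rewrite ?in_setT//; apply/eqP.
  by rewrite eqn_leq xmin// (cP _).2.
(* The fineness of the chain is dictated by the shell that f x occupies. *)
pose n := shell rho (mdist a (f x)).
exists x => y /(_ _ (shell_width_gt0 n)) xy.
suff [ay _] : mdist a (f y) < rho /\ (shell rho (mdist a (f y)) <= n)%N.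
  rewrite -fd; apply: le_lt_trans (metric_triangle _ a _) _.
  by rewrite [r]splitr ltrD// metric_sym; exact: (cP _).1.
apply: (linked_ind (P := fun z => mdist a (f z) < rho /\
  (shell rho (mdist a (f z)) <= n)%N) _ xy); last by split=> //; exact: (cP _).1.
move=> u v uv [au aun].
have [|av avn] := shell_trap (t' := mdist a (f v)) au aun.
  by apply: le_trans (metric_triangle _ (f u) _) _; rewrite lerD2l fd.
split=> //; apply: avn.
have := fb v; have := fb x.
by rewrite /color (ca v av) => -> ->.
Qed.

(** * Transitive ultrametric spaces are homogeneous *)

Section Ultrametric.
Context {R : realType} {T : metricType R}.
Context (Tultra : ultrametric T).
Implicit Types (x y z u v w : T).

Lemma ultrametric_isosceles x y z : mdist x y < mdist y z -> mdist x z = mdist y z.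
Proof.
move=> xy; apply/eqP; rewrite eq_le; apply/andP; split.
  by apply: le_trans (Tultra x y z) _; rewrite ge_max lexx ltW.
have := Tultra y x z; rewrite le_max => /orP[|//].
by rewrite (metric_sym y x) leNgt xy.
Qed.

(** An isometry k with k u = v maps the open ball of radius t = d(u, v) around u
    onto the one around v.  Exchanging these two disjoint balls by k and its
    inverse, and fixing everything else, is again an isometry, since in an
    ultrametric space a point outside a ball is equally far from all points of
    it.  A point w equidistant from u and v lies in neither ball, because
    t <= max(d(u, w), d(w, v)) = d(w, v). *)
Lemma ultrametric_swap u v :
  (exists k : T -> T, isometry setT setT k /\ k u = v) ->
  exists h : T -> T, [/\ isometry setT setT h, h u = v &
    forall w, mdist w u = mdist w v -> h w = w].
Proof.
move=> [k [kiso ku]].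
have [->|uv] := eqVneq u v.
  exists id; split=> //; apply: preserves_mdist_isometry => // y.
  by exists y.
have kd := isometry_preserves_mdist kiso.
have [k' [k'd kK k'K]] := isometry_inverse kiso.
have k'v : k' v = u by rewrite -ku kK.
set t := mdist u v.
have t0 : 0 < t by rewrite mdist_gt0.
pose U z := mdist u z < t; pose V z := mdist v z < t.
have UV z : U z -> V z = false.
  move=> uz; apply/negbTE; rewrite /V -leNgt.
  have := Tultra u z v; rewrite -/t le_max => /orP[|].
    by rewrite leNgt -/(U z) uz.
  by rewrite metric_sym.
pose h z := if U z then k z else if V z then k' z else z.
have Uk z : U z -> V (k z) by rewrite /V -ku kd.
have Vk' z : V z -> U (k' z) by rewrite /U -k'v k'd.
have VU z : V z -> U z = false.
  by move=> Vz; apply/negbTE/negP => /UV; rewrite Vz.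
have hU z : U z -> h z = k z by rewrite /h => ->.
have hV z : V z -> h z = k' z by move=> Vz; rewrite /h VU// Vz.
have hO z : U z = false -> V z = false -> h z = z by rewrite /h => -> ->.
have hK z : h (h z) = z.
  case Uz: (U z); first by rewrite (hU z)// hV ?Uk// kK.
  case Vz: (V z); first by rewrite (hV z)// hU ?Vk'// k'K.
  by rewrite !hO.
suff hd : preserves_mdist h.
  exists h; split.
  - by apply: preserves_mdist_isometry => // y; exists (h y).
  - by rewrite hU// /U mdistxx.
  - move=> w wuv; have tw : t <= mdist v w.
      have := Tultra u w v.
      by rewrite (metric_sym u w) wuv maxxx (metric_sym w v).
    have tu : t <= mdist u w by rewrite metric_sym wuv metric_sym.
    by rewrite hO// /U /V ltNge ?tu ?tw.
have tUV a b : U a -> V b -> mdist a b = t.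
  move=> Ua Vb.
  have vb : mdist u b = t.
    by rewrite metric_sym (@ultrametric_isosceles b v u) metric_sym// [ltRHS]metric_sym.
  by rewrite (@ultrametric_isosceles a u b) vb// metric_sym.
have out a : U a = false -> V a = false -> mdist u a = mdist v a.
  move=> /negbT; rewrite -leNgt => ua /negbT; rewrite -leNgt => va.
  apply/eqP; rewrite eq_le; apply/andP; split.
    by apply: le_trans (Tultra u v a) _; rewrite ge_max va lexx.
  apply: le_trans (Tultra v u a) _; rewrite ge_max lexx andbT.
  by rewrite metric_sym.
have Uout a b : U a -> U b = false -> mdist a b = mdist u b.
  move=> Ua /negbT; rewrite -leNgt => ub; apply: ultrametric_isosceles.
  by rewrite metric_sym; exact: lt_le_trans ub.
have Vout a b : V a -> V b = false -> mdist a b = mdist v b.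
  move=> Va /negbT; rewrite -leNgt => vb; apply: ultrametric_isosceles.
  by rewrite metric_sym; exact: lt_le_trans vb.
have hUV a b : U a -> U b = false -> mdist (h a) (h b) = mdist a b.
  move=> Ua Ub; rewrite (hU a)//; case Vb: (V b).
    by rewrite hV// metric_sym !tUV ?Vk' ?Uk.
  by rewrite hO// (Uout a)// (Vout (k a)) ?Uk// out.
have hVV a b : V a -> U b = false -> mdist (h a) (h b) = mdist a b.
  move=> Va Ub; rewrite (hV a)//; case Vb: (V b); first by rewrite hV// k'd.
  by rewrite hO// (Vout a)// (Uout (k' a)) ?Vk'// out.
move=> x y; case Ux: (U x).
  case Uy: (U y); first by rewrite !hU// kd.
  by rewrite hUV.
case Uy: (U y); first by rewrite metric_sym [RHS]metric_sym hUV.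
case Vx: (V x); first by rewrite hVV.
case Vy: (V y); first by rewrite metric_sym [RHS]metric_sym hVV.
by rewrite !hO.
Qed.

(** If g already agrees with f on s, then g a and f a have the same distances to
    the points f x with x in s; so the swap of g a and f a fixes those points,
    and composing it with g extends the agreement to a. *)
Lemma ultrametric_transitive_homogeneous :
  (forall x y, exists g : T -> T, isometry setT setT g /\ g x = y) ->
  homogeneous T.
Proof.
move=> trans A B f /finite_seqP[s ->] _ [_ fd].
elim: s fd => [|a s IH] fd.
  exists id; split=> //; apply: preserves_mdist_isometry => // y.
  by exists y.
have [|g [giso gs]] := IH.
  by move=> x y xs ys; apply: fd; rewrite /= inE ?xs ?ys orbT.
have gd := isometry_preserves_mdist giso.
have [h [hiso hga hfix]] := ultrametric_swap (trans (g a) (f a)).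
exists (h \o g); split.
  split; last by move=> x y _ _ /=; rewrite (isometry_preserves_mdist hiso) gd.
  exact: set_bij_comp giso.1 hiso.1.
move=> x /=; rewrite inE => /predU1P[->//|xs].
rewrite hfix gs// -gs// gd gs//.
by rewrite fd//= ?inE ?xs ?orbT ?eqxx.
Qed.

End Ultrametric.

(** * The theorem *)

(** An isometry moving x to the point p of [countable_indivisible_linked_near]
    moves y to a point at distance d(x, y) from p that is linked to p by
    arbitrarily fine chains, contrary to the choice of p for r = d(x, y). *)
Lemma dstar_eq0 (R : realType) (M : metricType R) (x y : M) :
  countable [set: M] -> homogeneous M -> indivisible M ->
  dstar x y = 0 -> x = y.
Proof.
move=> cM hom indiv xy0; apply/eqP/negPn/negP; rewrite -mdist_gt0 => xy.
have [p pP] := countable_indivisible_linked_near x cM indiv xy.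
have [g [giso gx]] := homogeneous_transitive hom x p.
suff: mdist p (g y) < mdist x y.
  by rewrite -gx (isometry_preserves_mdist giso) ltxx.
apply: pP => e e0; rewrite -gx; apply: dstar_lt_linked.
by rewrite dstar_isometry// xy0.
Qed.

Lemma metric_of_distance (R : realType) (T : choiceType) (d : T -> T -> R)
    (dxx : forall x, d x x = 0) (d0 : forall x y, d x y = 0 -> x = y)
    (dC : forall x y, d x y = d y x)
    (dT : forall y x z, d x z <= d x y + d y z) :
  exists c : Metric.axioms_ R T,
    forall x y : T, @mdist R (Metric.Pack c) x y = d x y.
Proof.
(* Unification does not decompose the class of the variable T into its two
   mixins, hence the explicit arguments. *)
pose m : isMetric.axioms_ R T _ _ := @isMetric.Axioms_ R T
  (Choice.choice_hasChoice_mixin (Choice.class T))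
  (Choice.eqtype_hasDecEq_mixin (Choice.class T)) d dxx d0 dC dT.
pose N : metricType R := HB.pack (Choice.sort T) m.
by exists (Metric.class N).
Qed.

(* [Metric.Pack c] is the metric space with carrier M and structure c; the
   first conjunct says that its distance is d-star. *)
Theorem theorem3p10 (R : realType) (M : metricType R)
    (Mcountable : countable [set: M])
    (Mhomogeneous : homogeneous M)
    (Mindivisible : indivisible M) :
  exists c : Metric.axioms_ R M,
    let Mstar : metricType R := Metric.Pack c in
    [/\ forall x y : M, @mdist R Mstar x y = dstar x y,
        homogeneous Mstar,
        indivisible Mstar &
        ultrametric Mstar].
Proof.
have [c cE] := @metric_of_distance R M (@dstar R M) dstarxx
  (fun x y => @dstar_eq0 R M x y Mcountable Mhomogeneous Mindivisible)
  dstar_sym dstar_triangle.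
exists c => Mstar; rewrite -/Mstar in cE.
have ultra : ultrametric Mstar by move=> x y z; rewrite !cE dstar_ultra.
split=> //.
  apply: ultrametric_transitive_homogeneous => // x y.
  have [g [giso gx]] := homogeneous_transitive Mhomogeneous x y.
  exists g; split=> //; split; first exact: giso.1.
  by move=> a b _ _; rewrite !cE dstar_isometry.
have copy (A : set M) : @contains_copy R M A -> @contains_copy R Mstar A.
  move=> [B [f [BA fiso]]]; exists B, f; split=> //; split; first exact: fiso.1.
  move=> x y _ _; rewrite !cE homogeneous_dstar_map //.
  exact: isometry_preserves_mdist fiso.
by move=> A B AUB AIB; have [/copy|/copy] := Mindivisible A B AUB AIB; [left|right].
Qed.
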